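(* Let $X$ be a topological space with a stratification $\Sigma$. The categories $\mathcal{S}h_X$ of sheaves on $X$ and $\mathcal{S}_\Sigma$ are equivalent, and the functors $R_\Sigma:\mathcal{S}h_X\to\mathcal{S}_\Sigma$ and $Q_\Sigma:\mathcal{S}_\Sigma\to\mathcal{S}h_X$ are quasi-inverse to each other.
   Context: Stratification: $X$ is the disjoint union of finitely many locally closed subsets $S_0,\dots,S_n$, where $S_k$ is the union of strata of dimension $k$, and $\bigcup_{j\le k}S_j$ is closed for each $k$. Let $i_k:S_k\hookrightarrow X$ be the inclusion. Sheaves take values in a fixed usual category (e.g. abelian groups or vector spaces). For $k<l$ and a sheaf $\mathcal F_l$ on $S_l$, $\eta_{kl}:i_{l*}\mathcal F_l\to i_{k*}i_k^{-1}i_{l*}\mathcal F_l$ is the adjunction morphism. $\mathcal{S}_\Sigma$: objects are families $(\{\mathcal F_k\}_{k\le n},\{f_{lk}\}_{k<l\le n})$ with $\mathcal F_k$ a sheaf on $S_k$ and $f_{lk}:\mathcal F_k\to i_k^{-1}i_{l*}\mathcal F_l$ morphisms of sheaves such that for $k<l<m$, $(i_k^{-1}i_{l*}f_{ml})\circ f_{lk}=(i_k^{-1}\eta_{lm})\circ f_{mk}$ as morphisms $\mathcal F_k\to i_k^{-1}i_{l*}i_l^{-1}i_{m*}\mathcal F_m$. Morphisms $(\{\mathcal F_k\},\{f_{lk}\})\to(\{\mathcal G_k\},\{g_{lk}\})$ are families $\phi_k:\mathcal F_k\to\mathcal G_k$ with $g_{lk}\circ\phi_k=(i_k^{-1}i_{l*}\phi_l)\circ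 f_{lk}$ for $k<l$. $R_\Sigma(\mathcal F)=(\{i_k^{-1}\mathcal F\},\{i_k^{-1}\mathcal F\to i_k^{-1}i_{l*}i_l^{-1}\mathcal F\})$ (adjunction morphisms), and $R_\Sigma(\phi)=\{i_k^{-1}\phi\}$. $Q_\Sigma(\{\mathcal F_k\},\{f_{lk}\})$ is the projective limit of the finite system formed by the sheaves $i_{k*}\mathcal F_k$ and $i_{k*}i_k^{-1}i_{l*}\mathcal F_l$ ($k<l$) with the maps $i_{k*}f_{lk}:i_{k*}\mathcal F_k\to i_{k*}i_k^{-1}i_{l*}\mathcal F_l$ and $\eta_{kl}:i_{l*}\mathcal F_l\to i_{k*}i_k^{-1}i_{l*}\mathcal F_l$; explicitly, its sections on an open $U$ are the families $(s_k)$ with $s_k\in\mathcal F_k(U\cap S_k)$ and $f_{lk}(s_k)=\eta_{kl}(s_l)$ for $k<l$. On morphisms it is given by the universal property. *)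

(* Defs.v *)
From HB Require Import structures.
From mathcomp Require Import all_boot all_order all_algebra generic_quotient.
From mathcomp Require Import all_classical topology.

Set Implicit Arguments.
Unset Strict Implicit.
Unset Printing Implicit Defensive.

Import GRing.Theory.

Local Open Scope classical_set_scope.
Local Open Scope quotient_scope.
Local Open Scope ring_scope.

Record category := Category {
  obj :> Type;
  mor : obj -> obj -> Type;
  idm : forall x, mor x x;
  compm : forall x y z, mor y z -> mor x y -> mor x z;
  comp1m : forall x y (f : mor x y), compm (idm y) f = f;
  compm1 : forall x y (f : mor x y), compm f (idm x) = f;
  compmA : forall x y z t (f : mor x y) (g : mor y z) (h : mor z t),
    compm h (compm g f) = compm (compm h g) f }.

Record functor (C D : category) := Functor {
  fobj :> C -> D;
  fmor : forall x y, mor x y -> mor (fobj x) (fobj y);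
  fmor1 : forall x, fmor (idm x) = idm (fobj x);
  fmorM : forall x y z (f : mor x y) (g : mor y z),
    fmor (compm g f) = compm (fmor g) (fmor f) }.

Definition id_functor (C : category) : functor C C :=
  @Functor C C id (fun x y f => f) (fun x => erefl) (fun x y z f g => erefl).

Program Definition comp_functor (C D E : category) (G : functor D E)
    (F : functor C D) : functor C E :=
  @Functor C E (fun x => G (F x)) (fun x y f => fmor G (fmor F f)) _ _.
Next Obligation. move=> *. by rewrite /= !fmor1. Qed.
Next Obligation. by move=> *; rewrite /= !fmorM. Qed.

Definition is_iso (C : category) (x y : C) (f : mor x y) : Prop :=
  exists g : mor y x, compm g f = idm x /\ compm f g = idm y.

Definition naturally_isomorphic (C D : category) (F G : functor C D) : Prop :=
  exists t : forall x, mor (F x) (G x),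
    (forall x y (f : mor x y), compm (t y) (fmor F f) = compm (fmor G f) (t x))
    /\ (forall x, is_iso (t x)).

Definition quasi_inverse (C D : category) (F : functor C D) (G : functor D C)
    : Prop :=
  naturally_isomorphic (comp_functor G F) (id_functor C) /\
  naturally_isomorphic (comp_functor F G) (id_functor D).

Definition equivalent_categories (C D : category) : Prop :=
  exists (F : functor C D) (G : functor D C), quasi_inverse F G.

Definition mklin (R : pzRingType) (U V : lmodType R) (f : U -> V)
    (lin_f : linear f) : {linear U -> V} :=
  HB.pack f (GRing.isLinear.Build R U V *:%R f lin_f).

Lemma linear_fun_eq (R : pzRingType) (U V : lmodType R)
  (f g : {linear U -> V}) : f =1 g -> f = g.
Proof.
case: f g => [f [[fD] [fZ]]] [g [[gD] [gZ]]] /= /funext fg.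
case: _ / fg gD gZ => gD gZ; case: fD gD => [fD0 fD] [gD0 gD].
rewrite (Prop_irrelevance fD0 gD0) (Prop_irrelevance fD gD).
by rewrite (Prop_irrelevance fZ gZ).
Qed.

Section DependentProduct.
Variables (R : pzRingType) (I : Type) (V : I -> lmodType R).

Definition dprod := forall i, V i.

HB.instance Definition _ := Choice.copy dprod (forall i, V i).

Let dadd (f g : dprod) : dprod := fun i => f i + g i.
Let dopp (f : dprod) : dprod := fun i => - f i.
Let dscale (a : R) (f : dprod) : dprod := fun i => a *: f i.
Let d0 : dprod := fun i => 0.

Let daddA : associative dadd.
Proof. by move=> f g h; apply: functional_extensionality_dep => i; exact: addrA. Qed.
Let daddC : commutative dadd.
Proof. by move=> f g; apply: functional_extensionality_dep => i; exact: addrC. Qed.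
Let dadd0 : left_id d0 dadd.
Proof. by move=> f; apply: functional_extensionality_dep => i; exact: add0r. Qed.
Let daddN : left_inverse d0 dopp dadd.
Proof. by move=> f; apply: functional_extensionality_dep => i; exact: addNr. Qed.

HB.instance Definition _ :=
  GRing.isZmodule.Build dprod daddA daddC dadd0 daddN.

Let dscaleA a b f : dscale a (dscale b f) = dscale (a * b) f.
Proof. by apply: functional_extensionality_dep => i; exact: scalerA. Qed.
Let dscale1 : left_id 1 dscale.
Proof. by move=> f; apply: functional_extensionality_dep => i; exact: scale1r. Qed.
Let dscaleDr : right_distributive dscale +%R.
Proof. by move=> a f g; apply: functional_extensionality_dep => i; exact: scalerDr. Qed.
Let dscaleDl f : {morph dscale^~ f : a b / a + b}.
Proof. by move=> a b; apply: functional_extensionality_dep => i; exact: scalerDl. Qed.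

HB.instance Definition _ := GRing.Zmodule_isLmodule.Build R dprod
  dscaleA dscale1 dscaleDr dscaleDl.

Lemma dprodE a (f g : dprod) i : (a *: f + g) i = a *: f i + g i.
Proof. by []. Qed.

End DependentProduct.

Definition submod_closed_prop (R : pzRingType) (V : lmodType R)
    (P : V -> Prop) : Prop :=
  P 0 /\ forall a u v, P u -> P v -> P (a *: u + v).

Section Submodule.
Variables (R : pzRingType) (V : lmodType R) (P : V -> Prop).
Variable closedP : submod_closed_prop P.

Definition submod_pred of submod_closed_prop P : pred V := fun v => `[< P v >].

Let submod_predP : subsemimod_closed (submod_pred closedP).
Proof.
have [P0 PL] := closedP; split; first split.
- by apply/asboolP.
- move=> u v /asboolP Pu /asboolP Pv; apply/asboolP.
  by rewrite -[u]scale1r; apply: PL.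
- by move=> a u /asboolP Pu; apply/asboolP; rewrite -[_ *: _]addr0; apply: PL.
Qed.

HB.instance Definition _ :=
  GRing.isSubmodClosed.Build R V (submod_pred closedP) submod_predP.

Definition submod := {v : V | submod_pred closedP v}.

HB.instance Definition _ := SubChoice.on submod.
HB.instance Definition _ := [SubChoice_isSubLmodule of submod by <:].

Definition mksub (v : V) (Pv : P v) : submod :=
  exist _ v (asboolT Pv).

Lemma submodP (s : submod) : P (val s).
Proof. by apply/asboolP; exact: (valP s). Qed.

Lemma submodE a (s t : submod) : val (a *: s + t) = a *: val s + val t.
Proof. by []. Qed.

End Submodule.

Record opens (X : topologicalType) := Opens {
  oset :> set X;
  osetP : open oset }.

Section Sheaves.
Variables (R : pzRingType) (X : topologicalType).

Definition opensI (U V : opens X) : opens X :=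
  Opens (openI (osetP U) (osetP V)).

Lemma opensIl (U V : opens X) : opensI U V `<=` U.
Proof. exact: subIsetl. Qed.

Lemma opensIr (U V : opens X) : opensI U V `<=` V.
Proof. exact: subIsetr. Qed.

Arguments opensIl U V [t] _.
Arguments opensIr U V [t] _.

(* Values are left modules over a fixed ring [R]: vector spaces when [R] is a
   field, abelian groups when [R] is [int]. *)
Record presheaf := Presheaf {
  psec :> opens X -> lmodType R;
  res : forall U V : opens X, U `<=` V -> {linear psec V -> psec U};
  res_id : forall (U : opens X) (h : U `<=` U) s, res h s = s;
  res_comp : forall (U V W : opens X) (h : U `<=` V) (k : V `<=` W)
    (l : U `<=` W) s, res h (res k s) = res l s }.

Definition is_sheaf (F : presheaf) : Prop :=
  forall (U : opens X) (I : Type) (V : I -> opens X)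
    (VU : forall i, V i `<=` U), U `<=` \bigcup_i V i ->
  forall s : (forall i, F (V i)),
    (forall i j, res F (opensIl (V i) (V j)) (s i) =
                 res F (opensIr (V i) (V j)) (s j)) ->
  exists! t : F U, forall i, res F (VU i) t = s i.

Record sheaf := Sheaf { shpsh :> presheaf; sheafP : is_sheaf shpsh }.

Lemma sheaf_sep (F : sheaf) (U : opens X) (I : Type) (V : I -> opens X)
    (VU : forall i, V i `<=` U) (t t' : F U) : U `<=` \bigcup_i V i ->
  (forall i, res F (VU i) t = res F (VU i) t') -> t = t'.
Proof.
move=> cov e; have [|z [_ zu]] := @sheafP F U I V VU cov (fun i => res F (VU i) t).
  move=> i j; rewrite (res_comp _ _ (subset_trans (opensIl _ _) (VU i))).
  by rewrite (res_comp _ _ (subset_trans (opensIl _ _) (VU i))).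
by rewrite -(zu t) // -(zu t') // => i; rewrite e.
Qed.

Record shmor (F G : presheaf) := ShMor {
  shapp :> forall U, {linear F U -> G U};
  shapp_res : forall (U V : opens X) (h : U `<=` V) s,
    shapp U (res F h s) = res G h (shapp V s) }.

Lemma shmor_eq (F G : presheaf) (f g : shmor F G) :
  (forall U s, f U s = g U s) -> f = g.
Proof.
case: f g => [f fP] [g gP] /= fg.
have e : f = g.
  by apply: functional_extensionality_dep => U; apply: linear_fun_eq => s; exact: fg.
by move: fP gP; rewrite e => fP gP; rewrite (Prop_irrelevance fP gP).
Qed.

Program Definition shid (F : presheaf) : shmor F F :=
  @ShMor F F (fun U => @mklin _ _ _ (fun s => s) _) _.
Next Obligation. by []. Qed.
Next Obligation. by []. Qed.

Program Definition shcomp (F G H : presheaf) (g : shmor G H) (f : shmor F G) :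
    shmor F H :=
  @ShMor F H (fun U => @mklin _ _ _ (fun s => g U (f U s)) _) _.
Next Obligation. by move=> * a u v; rewrite /= !linearP. Qed.
Next Obligation. by move=> *; rewrite /= !shapp_res. Qed.

Program Definition Sh : category :=
  @Category sheaf shmor shid (fun F G H => @shcomp F G H) _ _ _.
Next Obligation. by move=> *; exact: shmor_eq. Qed.
Next Obligation. by move=> *; exact: shmor_eq. Qed.
Next Obligation. by move=> *; exact: shmor_eq. Qed.

End Sheaves.

Arguments opensIl {X} U V [t] _.
Arguments opensIr {X} U V [t] _.
Arguments res {R X} p {U V} _.

Section Stalk.
Variables (R : pzRingType) (X : topologicalType) (F : presheaf R X) (x : X).

Record germ_rep := GermRep {
  gdom : opens X;
  gmem : oset gdom x;
  gsec : F gdom }.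

HB.instance Definition _ := gen_eqMixin germ_rep.
HB.instance Definition _ := gen_choiceMixin germ_rep.

Definition germ_eq (g h : germ_rep) : Prop :=
  exists (W : opens X) (Wg : W `<=` gdom g) (Wh : W `<=` gdom h),
    oset W x /\ res F Wg (gsec g) = res F Wh (gsec h).

Definition germ_eqb : rel germ_rep := fun g h => `[< germ_eq g h >].

Let germ_eqb_refl : reflexive germ_eqb.
Proof.
move=> g; apply/asboolP; exists (gdom g), (@subset_refl _ _), (@subset_refl _ _).
by split=> //; exact: gmem.
Qed.

Let germ_eqb_sym : symmetric germ_eqb.
Proof.
by move=> g h; apply/asboolP/asboolP => -[W [Wg [Wh [Wx e]]]]; exists W, Wh, Wg.
Qed.

Let germ_eqb_trans : transitive germ_eqb.
Proof.
move=> h g k /asboolP[W [Wg [Wh [Wx e]]]] /asboolP[W' [W'h [W'k [W'x e']]]].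
apply/asboolP.
have l : opensI W W' `<=` W by exact: opensIl.
have r : opensI W W' `<=` W' by exact: opensIr.
exists (opensI W W'), (subset_trans l Wg), (subset_trans r W'k); split=> //.
rewrite -(res_comp l Wg) e (res_comp _ _ (subset_trans l Wh)).
by rewrite -(res_comp r W'k) -e' (res_comp _ _ (subset_trans l Wh)).
Qed.

Canonical germ_equiv :=
  EquivRel germ_eqb germ_eqb_refl germ_eqb_sym germ_eqb_trans.

Definition stalk := {eq_quot germ_equiv}.

HB.instance Definition _ := Choice.on stalk.
HB.instance Definition _ := EqQuotient.on stalk.

Definition germ (U : opens X) (Ux : oset U x) (s : F U) : stalk :=
  \pi_stalk (GermRep Ux s).

Lemma germ_eqP (U V : opens X) (Ux : oset U x) (Vx : oset V x) (s : F U) (t : F V) :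
  germ Ux s = germ Vx t <-> germ_eq (GermRep Ux s) (GermRep Vx t).
Proof.
split=> [e|e]; first exact/asboolP/(eqmodP germ_equiv).
exact/(eqmodP germ_equiv)/asboolP.
Qed.

Lemma germ_res (U V : opens X) (h : U `<=` V) (Ux : oset U x) (Vx : oset V x) (s : F V) :
  germ Ux (res F h s) = germ Vx s.
Proof.
apply/germ_eqP; exists U, (@subset_refl _ _), h; split=> //=.
exact: res_comp.
Qed.

Lemma stalkW (P : stalk -> Prop) :
  (forall U (Ux : oset U x) (s : F U), P (germ Ux s)) -> forall g, P g.
Proof. by move=> H; elim/quotW => -[U Ux s]; exact: H. Qed.

Let st0 : stalk := @germ (Opens openT) I 0.

Let stopp (g : stalk) : stalk := germ (gmem (repr g)) (- gsec (repr g)).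

Let stadd (g h : stalk) : stalk :=
  @germ (opensI (gdom (repr g)) (gdom (repr h)))
    (conj (gmem (repr g)) (gmem (repr h)))
    (res F (opensIl _ _) (gsec (repr g)) +
     res F (opensIr _ _) (gsec (repr h))).

Let stscale (a : R) (g : stalk) : stalk :=
  germ (gmem (repr g)) (a *: gsec (repr g)).

Let repr_germ U (Ux : oset U x) (s : F U) :
  germ_eq (repr (germ Ux s)) (GermRep Ux s).
Proof. by apply/asboolP/(eqmodP germ_equiv); rewrite reprK. Qed.

Let stoppE U (Ux : oset U x) (s : F U) : stopp (germ Ux s) = germ Ux (- s).
Proof.
have [W [Wg [Wh [Wx e]]]] := repr_germ Ux s.
apply/germ_eqP; exists W, Wg, Wh; split=> //=.
by rewrite !linearN /= e.
Qed.

Let stscaleE a U (Ux : oset U x) (s : F U) : stscale a (germ Ux s) = germ Ux (a *: s).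
Proof.
have [W [Wg [Wh [Wx e]]]] := repr_germ Ux s.
apply/germ_eqP; exists W, Wg, Wh; split=> //=.
by rewrite !linearZ /= e.
Qed.

Let stadd_gen U (Ux : oset U x) (s : F U) V (Vx : oset V x) (t : F V)
    (W : opens X) (Wx : oset W x) (WU : W `<=` U) (WV : W `<=` V) :
  stadd (germ Ux s) (germ Vx t) = germ Wx (res F WU s + res F WV t).
Proof.
have [O [Og [Oh [Ox e]]]] := repr_germ Ux s.
have [O' [Og' [Oh' [Ox' e']]]] := repr_germ Vx t.
pose Z := opensI W (opensI O O').
have ZW : Z `<=` W by exact: opensIl.
have ZO : Z `<=` O by move=> z [_ []].
have ZO' : Z `<=` O' by move=> z [_ []].
apply/germ_eqP; rewrite /=.
unshelve eexists Z, _, ZW => /=.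
  by move=> z [Wz [Oz Oz']]; split; [exact: (Og z Oz)|exact: (Og' z Oz')].
split; first by split.
rewrite !linearD /=.
rewrite (res_comp _ _ (subset_trans ZO Og)) (res_comp _ _ (subset_trans ZO' Og')).
rewrite -(res_comp ZO Og) -(res_comp ZO' Og') e e' /=.
rewrite (res_comp _ _ (subset_trans ZW WU)) (res_comp _ _ (subset_trans ZW WV)).
by rewrite (res_comp _ _ (subset_trans ZW WU)) (res_comp _ _ (subset_trans ZW WV)).
Qed.

Let staddE U (Ux : oset U x) (s t : F U) :
  stadd (germ Ux s) (germ Ux t) = germ Ux (s + t).
Proof. by rewrite (stadd_gen _ _ _ _ Ux (@subset_refl _ _) (@subset_refl _ _)) !res_id. Qed.

Let germ2W (P : stalk -> stalk -> Prop) :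
  (forall U (Ux : oset U x) (s t : F U), P (germ Ux s) (germ Ux t)) ->
  forall g h, P g h.
Proof.
move=> H; elim/stalkW => U Ux s; elim/stalkW => V Vx t.
have l : opensI U V `<=` U by exact: opensIl.
have r : opensI U V `<=` V by exact: opensIr.
have W : oset (opensI U V) x by split.
by rewrite -(germ_res l W Ux s) -(germ_res r W Vx t); exact: H.
Qed.

Let germ3W (P : stalk -> stalk -> stalk -> Prop) :
  (forall U (Ux : oset U x) (s t u : F U), P (germ Ux s) (germ Ux t) (germ Ux u)) ->
  forall g h k, P g h k.
Proof.
move=> H; elim/stalkW => U Ux s; elim/stalkW => V Vx t; elim/stalkW => W Wx u.
pose Z := opensI U (opensI V W).
have ZU : Z `<=` U by exact: opensIl.
have ZV : Z `<=` V by move=> z [_ []].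
have ZW : Z `<=` W by move=> z [_ []].
have Zx : oset Z x by split.
rewrite -(germ_res ZU Zx Ux s) -(germ_res ZV Zx Vx t) -(germ_res ZW Zx Wx u).
exact: H.
Qed.

Let st0E U (Ux : oset U x) : st0 = germ Ux 0.
Proof.
rewrite /st0 -(@germ_res _ (Opens openT) (fun _ _ => I) Ux).
by rewrite linear0.
Qed.

Let staddA : associative stadd.
Proof. by refine (germ3W _) => U Ux s t u; rewrite !staddE addrA. Qed.
Let staddC : commutative stadd.
Proof. by refine (germ2W _) => U Ux s t; rewrite !staddE addrC. Qed.
Let stadd0 : left_id st0 stadd.
Proof. by elim/stalkW => U Ux s; rewrite (st0E Ux) staddE add0r. Qed.
Let staddN : left_inverse st0 stopp stadd.
Proof. by elim/stalkW => U Ux s; rewrite stoppE staddE addNr (st0E Ux). Qed.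

HB.instance Definition _ :=
  GRing.isZmodule.Build stalk staddA staddC stadd0 staddN.

Let stscaleA a b g : stscale a (stscale b g) = stscale (a * b) g.
Proof. by elim/stalkW: g => U Ux s; rewrite !stscaleE scalerA. Qed.
Let stscale1 : left_id 1 stscale.
Proof. by elim/stalkW => U Ux s; rewrite !stscaleE scale1r. Qed.
Let stscaleDr : right_distributive stscale +%R.
Proof.
move=> a; refine (germ2W _) => U Ux s t.
change (stscale a (stadd (germ Ux s) (germ Ux t)) =
  stadd (stscale a (germ Ux s)) (stscale a (germ Ux t))).
by rewrite staddE !stscaleE staddE scalerDr.
Qed.
Let stscaleDl g : {morph stscale^~ g : a b / a + b}.
Proof.
move=> a b; elim/stalkW: g => U Ux s.
change (stscale (a + b) (germ Ux s) =
  stadd (stscale a (germ Ux s)) (stscale b (germ Ux s))).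
by rewrite !stscaleE !staddE scalerDl.
Qed.

HB.instance Definition _ := GRing.Zmodule_isLmodule.Build R stalk
  stscaleA stscale1 stscaleDr stscaleDl.

Lemma germ_linear (U : opens X) (Ux : oset U x) : linear (@germ U Ux).
Proof.
move=> a s t.
change (germ Ux (a *: s + t) = stadd (stscale a (germ Ux s)) (germ Ux t)).
by rewrite stscaleE staddE.
Qed.

Lemma germ0 (U : opens X) (Ux : oset U x) : @germ U Ux 0 = 0.
Proof. exact: (linear0 (mklin (germ_linear Ux))). Qed.

End Stalk.

Arguments germ {R X} F {x U} Ux s.

Section StalkMap.
Variables (R : pzRingType) (X : topologicalType) (F G : presheaf R X).
Variables (f : shmor F G) (x : X).

Definition stalk_map (g : stalk F x) : stalk G x :=
  germ G (gmem (repr g)) (f _ (gsec (repr g))).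

Lemma stalk_map_germ (U : opens X) (Ux : oset U x) (s : F U) :
  stalk_map (germ F Ux s) = germ G Ux (f U s).
Proof.
have /germ_eqP[W [Wg [Wh [Wx e]]]] :
    germ F (gmem (repr (germ F Ux s))) (gsec (repr (germ F Ux s))) = germ F Ux s.
  by rewrite -[RHS]reprK /germ; case: (repr _).
apply/germ_eqP; exists W, Wg, Wh; split=> //=.
by move: e => /= e; rewrite -!shapp_res e.
Qed.

Lemma stalk_map_linear : linear stalk_map.
Proof.
move=> a; elim/stalkW => U Ux s; elim/stalkW => V Vx t.
have l : opensI U V `<=` U by exact: opensIl.
have r : opensI U V `<=` V by exact: opensIr.
have W : oset (opensI U V) x by split.
rewrite -(germ_res l W Ux s) -(germ_res r W Vx t).
by rewrite -germ_linear !stalk_map_germ linearP germ_linear.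
Qed.

End StalkMap.

Section Images.
Variables (R : pzRingType) (Y X : topologicalType) (f : continuousType Y X).

Definition opreim (U : opens X) : opens Y :=
  Opens (open_comp (fun y _ => @cts_fun _ _ f y) (osetP U)).

Lemma opreimS (U V : opens X) : U `<=` V -> opreim U `<=` opreim V.
Proof. by move=> UV y; exact: UV. Qed.

Section Push.
Variable F : sheaf R Y.

Program Definition push_presheaf : presheaf R X :=
  @Presheaf R X (fun U => F (opreim U)) (fun U V h => res F (opreimS h)) _ _.
Next Obligation. by move=> *; exact: res_id. Qed.
Next Obligation. by move=> *; exact: res_comp. Qed.

Lemma push_is_sheaf : is_sheaf push_presheaf.
Proof.
move=> U I V VU cov s sc.
apply: (@sheafP _ _ F (opreim U) I (fun i => opreim (V i))
         (fun i => opreimS (VU i))).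
  by move=> y /cov[i _ Vi]; exists i.
move=> i j; have := sc i j; rewrite /= => e.
have h : opensI (opreim (V i)) (opreim (V j)) `<=` opreim (opensI (V i) (V j)).
  by [].
have := congr1 (res F h) e.
by rewrite (res_comp _ _ (opensIl _ _)) (res_comp _ _ (opensIr _ _)).
Qed.

Definition push : sheaf R X := Sheaf push_is_sheaf.

End Push.

Program Definition push_map (F G : sheaf R Y) (phi : shmor F G) :
    shmor (push F) (push G) :=
  @ShMor _ _ (push F) (push G) (fun U => phi (opreim U)) _.
Next Obligation. by move=> F G phi U V h s; exact: (shapp_res phi (opreimS h)). Qed.

(* f^{-1}F is the sheaf associated with V |-> colim F(U) over the open U
   containing f(V), whose stalk at y is F_{f(y)}: a section over V is a family
   of germs (s_y in F_{f(y)})_{y in V} locally induced by sections of F. *)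
Section Pull.
Variable F : presheaf R X.

Local Notation germ_family V :=
  (dprod (fun y : Y => dprod (fun _ : oset V y => stalk F (f y)))).

Definition locally_section (V : opens Y) (s : germ_family V) : Prop :=
  forall (y0 : Y) (Vy0 : oset V y0), exists (W : opens Y) (U : opens X) (t : F U)
    (WU : W `<=` opreim U),
    oset W y0 /\
    forall y (Vy : oset V y) (Wy : oset W y), s y Vy = germ F (WU y Wy) t.

Lemma locally_section_closed (V : opens Y) :
  submod_closed_prop (@locally_section V).
Proof.
split.
  move=> y0 Vy0.
  exists (opreim (Opens openT)), (Opens openT), 0, (@subset_refl _ _).
  by split=> // y Vy Wy; rewrite germ0.
move=> a u v Pu Pv y0 Vy0.
have [W [U [t [WU [Wy e]]]]] := Pu y0 Vy0.
have [W' [U' [t' [WU' [Wy' e']]]]] := Pv y0 Vy0.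
have h : opensI W W' `<=` opreim (opensI U U').
  by move=> y [p q]; split; [exact: (WU y p)|exact: (WU' y q)].
have l : opensI U U' `<=` U by exact: opensIl.
have r : opensI U U' `<=` U' by exact: opensIr.
exists (opensI W W'), (opensI U U'), (a *: res F l t + res F r t'), h.
split=> // y Vy Wyy; rewrite !dprodE germ_linear.
rewrite (e y Vy (proj1 Wyy)) (e' y Vy (proj2 Wyy)).
by rewrite (germ_res l _ (WU _ (proj1 Wyy))) (germ_res r _ (WU' _ (proj2 Wyy))).
Qed.

Definition pull_sec (V : opens Y) : lmodType R :=
  submod (@locally_section_closed V).

Lemma pull_res_subproof (V W : opens Y) (h : V `<=` W) (s : pull_sec W) :
  @locally_section V (fun y Vy => val s y (h y Vy)).
Proof.
move=> y0 Vy0; have [O [U [t [OU [Oy e]]]]] := submodP s y0 (h y0 Vy0).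
by exists O, U, t, OU; split=> // y Vy Oy'; exact: e.
Qed.

Lemma pull_res_linear (V W : opens Y) (h : V `<=` W) :
  linear (fun s => mksub (@locally_section_closed V) (pull_res_subproof h s)).
Proof. by move=> a s t; apply: val_inj. Qed.

Program Definition pull_presheaf : presheaf R Y :=
  @Presheaf R Y pull_sec (fun V W h => mklin (pull_res_linear h)) _ _.
Next Obligation.
move=> U h s; apply: val_inj; apply: functional_extensionality_dep => y /=.
by apply: functional_extensionality_dep => Uy; congr (val s y _).
Qed.
Next Obligation.
move=> U V W h k l s; apply: val_inj.
apply: functional_extensionality_dep => y /=.
by apply: functional_extensionality_dep => Uy; congr (val s y _).
Qed.

Lemma pull_is_sheaf : is_sheaf pull_presheaf.
Proof.
move=> U I V VU cov s sc.
have sE i j y (p : oset (V i) y) (q : oset (V j) y) : val (s i) y p = val (s j) y q.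
  have := congr1 (fun z : pull_sec (opensI (V i) (V j)) => val z y (conj p q)) (sc i j).
  move=> /= e; rewrite -[LHS]/(sval (s i) y p).
  have -> : p = opensIl _ _ (conj p q) by exact: Prop_irrelevance.
  by rewrite [LHS]e; congr (sval (s j) y _); exact: Prop_irrelevance.
have ex y (Uy : oset U y) : exists i, oset (V i) y.
  by have [i _ Vi] := cov y Uy; exists i.
pose t : germ_family U := fun y Uy =>
  val (s (projT1 (cid (ex y Uy)))) y (projT2 (cid (ex y Uy))).
have tE i y (Uy : oset U y) (Vy : oset (V i) y) : t y Uy = val (s i) y Vy by exact: sE.
have tP : @locally_section U t.
  move=> y Uy; have [i Viy] := ex y Uy.
  have [W [O [w [WO [Wy e]]]]] := submodP (s i) y Viy.
  have h : opensI W (V i) `<=` opreim O by move=> z [p _]; exact: (WO z p).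
  exists (opensI W (V i)), O, w, h; split=> // z Uz [p q].
  by rewrite (tE i z Uz q) (e z q p) (Prop_irrelevance (h z _) (WO z p)).
exists (mksub (@locally_section_closed U) tP); split.
  move=> i; apply: val_inj; apply: functional_extensionality_dep => y /=.
  by apply: functional_extensionality_dep => Vy; exact: tE.
move=> t' t'E; apply: val_inj; apply: functional_extensionality_dep => y /=.
apply: functional_extensionality_dep => Uy; have [i Viy] := ex y Uy.
rewrite (tE i y Uy Viy) -(t'E i) /=; congr (val t' y _).
exact: Prop_irrelevance.
Qed.

Definition pull : sheaf R Y := Sheaf pull_is_sheaf.

End Pull.

Section PullMap.
Variables (F G : presheaf R X) (phi : shmor F G).

Lemma pull_map_subproof (V : opens Y) (s : pull F V) :
  locally_section (F := G) (V := V) (fun y Vy => stalk_map phi (val s y Vy)).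
Proof.
move=> y0 Vy0; have [W [U [t [WU [Wy e]]]]] := submodP s y0 Vy0.
exists W, U, (phi U t), WU; split=> // y Vy Wy'.
by rewrite (e y Vy Wy') stalk_map_germ.
Qed.

Lemma pull_map_linear (V : opens Y) : linear (fun s : pull F V =>
  mksub (@locally_section_closed G V) (pull_map_subproof s)).
Proof.
move=> a s t; apply: val_inj; apply: functional_extensionality_dep => y.
by apply: functional_extensionality_dep => Vy; exact: stalk_map_linear.
Qed.

Program Definition pull_map : shmor (pull F) (pull G) :=
  @ShMor _ _ (pull F) (pull G) (fun V => mklin (@pull_map_linear V)) _.
Next Obligation. by move=> U V h s; apply: val_inj. Qed.

End PullMap.

Section Unit.
Variable F : sheaf R X.

Lemma adj_unit_subproof (U : opens X) (s : F U) :
  locally_section (F := F) (V := opreim U) (fun y Uy => germ F Uy s).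
Proof.
move=> y0 Vy0; exists (opreim U), U, s, (@subset_refl _ _); split=> // y Vy Wy.
by congr (germ F _ s); exact: Prop_irrelevance.
Qed.

Lemma adj_unit_linear (U : opens X) : linear (fun s : F U =>
  mksub (@locally_section_closed F (opreim U)) (adj_unit_subproof s)).
Proof.
move=> a s t; apply: val_inj; apply: functional_extensionality_dep => y.
by apply: functional_extensionality_dep => Vy; exact: germ_linear.
Qed.

(* The adjunction morphism F -> f_* f^{-1} F: s |-> (germ of s at f(y))_y. *)
Program Definition adj_unit : shmor F (push (pull F)) :=
  @ShMor _ _ F (push (pull F)) (fun U => mklin (@adj_unit_linear U)) _.
Next Obligation.
move=> U V h s; apply: val_inj; apply: functional_extensionality_dep => y.
by apply: functional_extensionality_dep => Vy; exact: germ_res.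
Qed.

End Unit.

Lemma pull_map_id (F : presheaf R X) : pull_map (shid F) = shid (pull F).
Proof.
apply: shmor_eq => V s; apply: val_inj; apply: functional_extensionality_dep => y.
apply: functional_extensionality_dep => Vy /=.
by elim/stalkW: (val s y Vy) => U Ux t; rewrite stalk_map_germ.
Qed.

Lemma pull_map_comp (F G H : presheaf R X) (g : shmor G H) (h : shmor F G) :
  pull_map (shcomp g h) = shcomp (pull_map g) (pull_map h).
Proof.
apply: shmor_eq => V s; apply: val_inj; apply: functional_extensionality_dep => y.
apply: functional_extensionality_dep => Vy /=.
by elim/stalkW: (val s y Vy) => U Ux t; rewrite !stalk_map_germ.
Qed.

Lemma push_map_id (F : sheaf R Y) : push_map (shid F) = shid (push F).
Proof. exact: shmor_eq. Qed.

Lemma push_map_comp (F G H : sheaf R Y) (g : shmor G H) (h : shmor F G) :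
  push_map (shcomp g h) = shcomp (push_map (F := G) g) (push_map h).
Proof. exact: shmor_eq. Qed.

Lemma adj_unit_nat (F G : sheaf R X) (phi : shmor F G) :
  shcomp (adj_unit G) phi = shcomp (push_map (pull_map phi)) (adj_unit F).
Proof.
apply: shmor_eq => V s; apply: val_inj; apply: functional_extensionality_dep => y.
by apply: functional_extensionality_dep => Vy /=; rewrite stalk_map_germ.
Qed.

End Images.

Lemma shcompA (R : pzRingType) (X : topologicalType) (F G H K : presheaf R X)
    (f : shmor F G) (g : shmor G H) (h : shmor H K) :
  shcomp h (shcomp g f) = shcomp (shcomp h g) f.
Proof. exact: shmor_eq. Qed.

Definition locally_closed (X : topologicalType) (A : set X) : Prop :=
  exists U C : set X, [/\ open U, closed C & A = U `&` C].

(* [strat k] is the union S_k of the strata of dimension k; it may be empty.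
   The individual strata play no role beyond these unions. *)
Record stratification (X : topologicalType) := Stratification {
  sdim : nat;
  strat :> 'I_sdim.+1 -> set X;
  strat_disjoint : trivIset setT strat;
  strat_cover : \bigcup_k strat k = setT;
  strat_locally_closed : forall k, locally_closed (strat k);
  strat_closed : forall k : 'I_sdim.+1,
    closed (\bigcup_(j in [set j : 'I_sdim.+1 | (j <= k)%N]) strat j) }.

Definition incl (X : topologicalType) (A : set X) : A -> X := set_val.

HB.instance Definition _ (X : topologicalType) (A : set X) :=
  isContinuous.Build A X (@incl X A) (@initial_continuous A X set_val).

Section StratifiedSheaves.
Variables (R : pzRingType) (X : topologicalType) (S : stratification X).

Local Notation idx := 'I_(sdim S).+1.
Local Notation i_ k := (@incl X (S k)).

(* [glue kl] is f_{lk} : F_k -> i_k^{-1} i_{l*} F_l. *)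
Record strat_sheaf := StratSheaf {
  ssh :> forall k : idx, sheaf R (S k);
  glue : forall k l : idx, (k < l)%N ->
    shmor (ssh k) (pull (i_ k) (push (i_ l) (ssh l)));
  glueP : forall (k l m : idx) (kl : (k < l)%N) (lm : (l < m)%N) (km : (k < m)%N),
    shcomp (pull_map (i_ k) (push_map (i_ l) (glue lm))) (glue kl) =
    shcomp (pull_map (i_ k) (adj_unit (i_ l) (push (i_ m) (ssh m)))) (glue km) }.

Record strat_mor (F G : strat_sheaf) := StratMor {
  smor :> forall k : idx, shmor (F k) (G k);
  smorP : forall (k l : idx) (kl : (k < l)%N),
    shcomp (glue G kl) (smor k) =
    shcomp (pull_map (i_ k) (push_map (i_ l) (smor l))) (glue F kl) }.

Lemma strat_mor_eq (F G : strat_sheaf) (f g : strat_mor F G) :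
  (forall k, f k = g k) -> f = g.
Proof.
case: f g => [f fP] [g gP] /= fg.
have e : f = g by exact: functional_extensionality_dep.
by move: fP gP; rewrite e => fP gP; rewrite (Prop_irrelevance fP gP).
Qed.

Program Definition strat_id (F : strat_sheaf) : strat_mor F F :=
  @StratMor F F (fun k => shid (F k)) _.
Next Obligation.
by move=> F k l kl; rewrite push_map_id pull_map_id; exact: shmor_eq.
Qed.

Program Definition strat_comp (F G H : strat_sheaf) (g : strat_mor G H)
    (f : strat_mor F G) : strat_mor F H :=
  @StratMor F H (fun k => shcomp (g k) (f k)) _.
Next Obligation.
move=> F G H g f k l kl.
by rewrite push_map_comp pull_map_comp shcompA smorP -!shcompA smorP.
Qed.

Program Definition StratSh : category :=
  @Category strat_sheaf strat_mor strat_id (fun F G H => @strat_comp F G H) _ _ _.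
Next Obligation. by move=> *; apply: strat_mor_eq => k; exact: shmor_eq. Qed.
Next Obligation. by move=> *; apply: strat_mor_eq => k; exact: shmor_eq. Qed.
Next Obligation. by move=> *; apply: strat_mor_eq => k; exact: shmor_eq. Qed.

Program Definition restr_obj (F : sheaf R X) : strat_sheaf :=
  @StratSheaf (fun k => pull (i_ k) F)
    (fun k l _ => pull_map (i_ k) (adj_unit (i_ l) F)) _.
Next Obligation. by move=> F k l m *; rewrite -!pull_map_comp adj_unit_nat. Qed.

Program Definition restr_mor (F G : sheaf R X) (phi : shmor F G) :
    strat_mor (restr_obj F) (restr_obj G) :=
  @StratMor (restr_obj F) (restr_obj G) (fun k => pull_map (i_ k) phi) _.
Next Obligation. by move=> F G phi k l kl; rewrite -!pull_map_comp adj_unit_nat. Qed.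

Program Definition restr_functor : functor (Sh R X) StratSh :=
  @Functor (Sh R X) StratSh restr_obj restr_mor _ _.
Next Obligation. by move=> F; apply: strat_mor_eq => k; exact: pull_map_id. Qed.
Next Obligation.
by move=> F G H f g; apply: strat_mor_eq => k; exact: pull_map_comp.
Qed.

Section Glue.
Variable F : strat_sheaf.

Local Notation family U := (dprod (fun k : idx => push (i_ k) (F k) U)).

(* The right-hand side is eta_{kl}, so the compatible families are the sections
   of the limit of the i_{k*} F_k over the i_{k*} i_k^{-1} i_{l*} F_l. *)
Definition compatible (U : opens X) (s : family U) : Prop :=
  forall (k l : idx) (kl : (k < l)%N),
    push_map (i_ k) (glue F kl) U (s k) = adj_unit (i_ k) (push (i_ l) (F l)) U (s l).

Lemma compatible_closed (U : opens X) : submod_closed_prop (@compatible U).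
Proof.
split=> [k l kl|a s t sP tP k l kl]; first by rewrite !linear0.
by rewrite !dprodE !linearP sP tP.
Qed.

Definition glue_sec (U : opens X) : lmodType R := submod (@compatible_closed U).

Lemma glue_res_subproof (U V : opens X) (h : U `<=` V) (s : glue_sec V) :
  @compatible U (fun k => res (push (i_ k) (F k)) h (val s k)).
Proof. by move=> k l kl; rewrite !shapp_res (submodP s). Qed.

Lemma glue_res_linear (U V : opens X) (h : U `<=` V) :
  linear (fun s => mksub (@compatible_closed U) (glue_res_subproof h s)).
Proof.
move=> a s t; apply: val_inj; apply: functional_extensionality_dep => k.
exact: linearP.
Qed.

Program Definition glue_presheaf : presheaf R X :=
  @Presheaf R X glue_sec (fun U V h => mklin (glue_res_linear h)) _ _.
Next Obligation.
move=> U h s; apply: val_inj; apply: functional_extensionality_dep => k.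
exact: res_id.
Qed.
Next Obligation.
move=> U V W h k l s; apply: val_inj; apply: functional_extensionality_dep => j.
exact: res_comp.
Qed.

Lemma glue_is_sheaf : is_sheaf glue_presheaf.
Proof.
move=> U I V VU cov s sc.
have ex k : exists t : push (i_ k) (F k) U, forall i, res _ (VU i) t = val (s i) k.
  have [|t [tP _]] := @sheafP _ _ (push (i_ k) (F k)) U I V VU cov
    (fun i => val (s i) k); last by exists t.
  move=> i j; exact: (congr1 (fun z : glue_sec (opensI (V i) (V j)) => val z k)
    (sc i j)).
pose t : family U := fun k => projT1 (cid (ex k)).
have tE k i : res _ (VU i) (t k) = val (s i) k by exact: (projT2 (cid (ex k))).
have tP : @compatible U t.
  move=> k l kl.
  apply: (@sheaf_sep _ _ (push (i_ k) (pull (i_ k) (push (i_ l) (F l))))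
    U I V VU) => // i.
  by rewrite -!shapp_res !tE; exact: (submodP (s i)).
exists (mksub (@compatible_closed U) tP); split.
  move=> i; apply: val_inj; apply: functional_extensionality_dep => k; exact: tE.
move=> t' t'E; apply: val_inj; apply: functional_extensionality_dep => k.
apply: (@sheaf_sep _ _ (push (i_ k) (F k)) U I V VU) => // i.
by rewrite [LHS]tE -(t'E i).
Qed.

Definition glue_obj : sheaf R X := Sheaf glue_is_sheaf.

End Glue.

Section GlueMap.
Variables (F G : strat_sheaf) (phi : strat_mor F G).

Lemma glue_mor_subproof (U : opens X) (s : glue_obj F U) :
  @compatible G U (fun k => push_map (i_ k) (phi k) U (val s k)).
Proof.
move=> k l kl.
have e1 := congr1 (fun m : shmor _ _ => m (opreim (i_ k) U) (val s k))
  (smorP phi kl).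
have e2 := congr1 (fun m : shmor _ _ => m U (val s l))
  (adj_unit_nat (i_ k) (push_map (i_ l) (phi l))).
refine (etrans e1 (etrans _ (esym e2))).
exact: (congr1 (pull_map (i_ k) (push_map (i_ l) (phi l)) (opreim (i_ k) U))
  (submodP s k l kl)).
Qed.

Lemma glue_mor_linear (U : opens X) : linear (fun s : glue_obj F U =>
  mksub (@compatible_closed G U) (glue_mor_subproof s)).
Proof.
move=> a s t; apply: val_inj; apply: functional_extensionality_dep => k.
exact: linearP.
Qed.

Program Definition glue_mor : shmor (glue_obj F) (glue_obj G) :=
  @ShMor _ _ (glue_obj F) (glue_obj G) (fun U => mklin (@glue_mor_linear U)) _.
Next Obligation.
move=> U V h s; apply: val_inj; apply: functional_extensionality_dep => k.
exact: shapp_res.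
Qed.

End GlueMap.

Program Definition glue_functor : functor StratSh (Sh R X) :=
  @Functor StratSh (Sh R X) glue_obj glue_mor _ _.
Next Obligation. by move=> F; apply: shmor_eq => U s; apply: val_inj. Qed.
Next Obligation. by move=> *; apply: shmor_eq => U s; apply: val_inj. Qed.

End StratifiedSheaves.

(* Main.v *)
(* Both natural isomorphisms are detected on germs.  The projections
   Q F -> i_{k*} F_k correspond by adjunction to i_k^{-1} Q F -> F_k.  At a point
   of S_k the strata S_l with l < k can be avoided, and the components of index
   l > k of a compatible family are determined near the point by the one of
   index k through f_{lk}; so these morphisms are bijective on stalks and give
   R Q ~ id.  For the other composite, the unit F -> Q R F becomes, after each
   i_k^{-1}, a right inverse of the isomorphism just found; hence it is bijective
   on all stalks, since the strata cover X. *)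
Require Import Defs.
From mathcomp Require Import all_boot all_algebra.
From mathcomp Require Import all_classical topology.
Import Defs.

Set Implicit Arguments.
Unset Strict Implicit.
Unset Printing Implicit Defensive.

Import GRing.Theory.

Local Open Scope classical_set_scope.
Local Open Scope ring_scope.

(** * Sections of a sheaf and their germs *)

Section SheafGerms.
Variables (R : pzRingType) (X : topologicalType).

Lemma res_irr (F : presheaf R X) (U V : opens X) (h h' : U `<=` V) (s : F V) :
  res F h s = res F h' s.
Proof. by rewrite (Prop_irrelevance h h'). Qed.

Lemma germ_irr (F : presheaf R X) (x : X) (U : opens X) (p q : oset U x) (s : F U) :
  germ F p s = germ F q s.
Proof. by rewrite (Prop_irrelevance p q). Qed.

Lemma stalk_germ (F : presheaf R X) (x : X) (g : stalk F x) :
  exists U (Ux : oset U x) (s : F U), g = germ F Ux s.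
Proof. by elim/stalkW: g => U Ux s; exists U, Ux, s. Qed.

Variable F : sheaf R X.

Lemma germ_inj (U : opens X) (s t : F U) :
  (forall x (Ux : oset U x), germ F Ux s = germ F Ux t) -> s = t.
Proof.
move=> st.
(* The index type collects all opens on which [s] and [t] already agree; equality of germs says that
   they cover [U]. *)
pose I := {W : opens X & {WU : W `<=` U | res F WU s = res F WU t}}.
apply: (@sheaf_sep _ _ F U I (fun i => projT1 i) (fun i => proj1_sig (projT2 i))).
  move=> x Ux; have /germ_eqP[W [/= WU [WU' [Wx e]]]] := st x Ux.
  rewrite (res_irr WU' WU) in e.
  by exists (existT _ W (exist _ WU e)).
by case=> W [WU e].
Qed.

(** Sections locally inducing [g] have the same germs on overlaps, hence agree there by [germ_inj],
    and the sheaf axiom glues them. The cover consists of all pairs of an open subset of [U] and a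
    section inducing [g] on it, so that no choice of neighbourhoods is made. *)
Lemma germ_glue (U : opens X) (g : forall x, oset U x -> stalk F x) :
    (forall x0, oset U x0 -> exists (W : opens X) (t : F W), oset W x0 /\
      forall x (Ux : oset U x) (Wx : oset W x), g x Ux = germ F Wx t) ->
  exists t : F U, forall x (Ux : oset U x), germ F Ux t = g x Ux.
Proof.
move=> gP.
pose I := {W : opens X & {t : F W | W `<=` U /\
  forall x (Ux : oset U x) (Wx : oset W x), g x Ux = germ F Wx t}}.
pose V (i : I) := projT1 i.
pose VU (i : I) : V i `<=` U := proj1 (proj2_sig (projT2 i)).
pose s (i : I) : F (V i) := proj1_sig (projT2 i).
have sE i x (Ux : oset U x) (Vx : oset (V i) x) : g x Ux = germ F Vx (s i).
  exact: (proj2 (proj2_sig (projT2 i))).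
have cov x : oset U x -> exists i, oset (V i) x.
  move=> Ux; have [W [t [Wx tE]]] := gP x Ux.
  have h : opensI U W `<=` W by exact: opensIr.
  have q : opensI U W `<=` U /\ forall y (Uy : oset U y)
      (Wy : oset (opensI U W) y), g y Uy = germ F Wy (res F h t).
    split=> [|y Uy Wy]; first exact: opensIl.
    rewrite (tE y Uy (h y Wy)); exact/esym/germ_res.
  by exists (existT _ (opensI U W) (exist _ (res F h t) q)).
have [|i j|t [tE _]] := @sheafP _ _ F U I V VU _ s.
- by move=> x /cov[i Vx]; exists i.
- apply: germ_inj => x [Vix Vjx].
  rewrite (germ_res _ _ Vix) (germ_res _ _ Vjx).
  by rewrite -(sE i x (VU i x Vix)) -(sE j x (VU i x Vix)).
exists t => x Ux; have [i Vx] := cov x Ux.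
rewrite (sE i x Ux Vx) -(tE i); exact/esym/germ_res.
Qed.

End SheafGerms.

(** * Isomorphism criteria for morphisms of sheaves *)

Lemma shmor_is_iso (R : pzRingType) (X : topologicalType) (F G : sheaf R X)
    (phi : shmor F G) :
  (forall U, injective (phi U)) -> (forall U t, exists s, phi U s = t) ->
  @is_iso (Sh R X) F G phi.
Proof.
move=> inj surj.
pose psi U t := projT1 (cid (surj U t)).
have psiK U t : phi U (psi U t) = t by exact: projT2 (cid (surj U t)).
(* The preimages are picked arbitrarily; injectivity of [phi] makes them linear and compatible with
   restriction. *)
have psi_linear U : linear (psi U).
  by move=> a u v; apply: inj; rewrite linearP !psiK.
have psi_res (U V : opens X) (h : U `<=` V) t :
    mklin (psi_linear U) (res G h t) = res F h (mklin (psi_linear V) t).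
  by apply: inj; rewrite shapp_res /= !psiK.
exists (ShMor psi_res); split; apply: shmor_eq => U s /=; last exact: psiK.
by apply: inj; rewrite psiK.
Qed.

Lemma shmor_is_iso_stalk (R : pzRingType) (X : topologicalType) (F G : sheaf R X)
    (phi : shmor F G) :
  (forall x, injective (@stalk_map _ _ _ _ phi x)) ->
  (forall x h, exists g, @stalk_map _ _ _ _ phi x g = h) ->
  @is_iso (Sh R X) F G phi.
Proof.
move=> inj surj; apply: shmor_is_iso => [U s t e|U t].
  by apply: germ_inj => x Ux; apply: inj; rewrite !stalk_map_germ e.
pose g x (Ux : oset U x) : stalk F x := projT1 (cid (surj x (germ G Ux t))).
have gE x (Ux : oset U x) : stalk_map phi (g x Ux) = germ G Ux t.
  exact: projT2 (cid (surj x (germ G Ux t))).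
have [|s sE] := @germ_glue _ _ F U g.
  (* A section [u] representing the preimage at [x0] maps to [t] near [x0]; injectivity on the
     nearby stalks then forces the germs of [u] to be the chosen preimages, so these glue. *)
  move=> x0 Ux0; have [V [Vx [u gu]]] := stalk_germ (g x0 Ux0).
  have := gE x0 Ux0; rewrite gu stalk_map_germ => /germ_eqP[W [/= WV [WU [Wx e]]]].
  exists W, (res F WV u); split=> // x Ux Wx'; apply: inj.
  by rewrite gE stalk_map_germ shapp_res e -(germ_res WU Wx').
by exists s; apply: germ_inj => x Ux; rewrite -stalk_map_germ sE gE.
Qed.

(** * Germs and stalks of inverse images *)

Section PullGerms.
Variables (R : pzRingType) (Y X : topologicalType) (f : continuousType Y X).
Variable F : sheaf R X.

Lemma pull_eq (V : opens Y) (s t : pull f F V) :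
  (forall y (Vy : oset V y), val s y Vy = val t y Vy) -> s = t.
Proof.
move=> st; apply: val_inj; apply: functional_extensionality_dep => y.
by apply: functional_extensionality_dep.
Qed.

(** This identifies the stalk of $f^{-1}F$ at $y$ with $F_{f(y)}$. Near $y$ both families come from
    sections of [F]; if these have the same germ at $f(y)$, they agree on an open [C] around it, and
    the families agree over the preimage of [C]. *)
Lemma pull_germE (V W : opens Y) (s : pull f F V) (t : pull f F W) (y : Y)
    (Vy : oset V y) (Wy : oset W y) :
  germ (pull f F) Vy s = germ (pull f F) Wy t <-> val s y Vy = val t y Wy.
Proof.
split=> [/germ_eqP[Z [/= ZV [ZW [Zy e]]]]|e].
  have := congr1 (fun u : pull f F Z => val u y Zy) e => /= {}e.
  by rewrite (Prop_irrelevance Vy (ZV y Zy)) (Prop_irrelevance Wy (ZW y Zy)).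
have [A [U [u [AU [Ay sE]]]]] := submodP s y Vy.
have [B [U' [u' [BU' [By tE]]]]] := submodP t y Wy.
move: e; rewrite (sE y Vy Ay) (tE y Wy By) => /germ_eqP[C [/= CU [CU' [Cy e]]]].
pose Z := opensI (opensI V W) (opensI (opensI A B) (opreim f C)).
have ZV : Z `<=` V by move=> z [[]].
have ZW : Z `<=` W by move=> z [[]].
apply/germ_eqP; exists Z, ZV, ZW; split; first by [].
apply: (@pull_eq Z) => z Zz /=; have [_ [[Az Bz] Cz]] := Zz.
rewrite (sE z _ Az) (tE z _ Bz).
by rewrite -(germ_res CU Cz) e (germ_res CU' Cz (BU' z Bz)).
Qed.

Variable G : sheaf R Y.

(** Uniqueness half of the adjunction: every germ of $f^{-1}F$ is the germ of a section in the image
    of the unit. *)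
Lemma pull_mor_ext (h h' : shmor (pull f F) G) :
  shcomp (push_map f h) (adj_unit f F) = shcomp (push_map f h') (adj_unit f F) ->
  h = h'.
Proof.
move=> e; apply: shmor_eq => V s; apply: germ_inj => y Vy.
have [U [Uy [u su]]] := stalk_germ (val s y Vy).
have /(pull_germE (W := opreim f U) s (adj_unit f F U u) Vy Uy) g :
  val s y Vy = val (adj_unit f F U u) y Uy by rewrite su.
rewrite -!stalk_map_germ g !stalk_map_germ; congr germ.
exact: (congr1 (fun m : shmor _ _ => m U u) e).
Qed.

End PullGerms.

Lemma stalk_map_pull_iso (R : pzRingType) (Y X : topologicalType)
    (f : continuousType Y X) (F H : sheaf R X) (phi : shmor F H) :
  @is_iso (Sh R Y) (pull f F) (pull f H) (pull_map f phi) ->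
  forall y, injective (@stalk_map _ _ _ _ phi (f y)) /\
    forall h, exists g, @stalk_map _ _ _ _ phi (f y) g = h.
Proof.
case=> psi [psiK phiK] y; split=> [g h|h].
  elim/stalkW: g => U Uy s; elim/stalkW: h => V Vy t.
  rewrite !stalk_map_germ => e.
  (* The unit lifts both germs to sections of the inverse image, where the inverse [psi] can be
     applied. *)
  have /pull_germE/(congr1 (@stalk_map _ _ _ _ psi y)) :
      val (pull_map f phi (opreim f U) (adj_unit f F U s)) y Uy =
      val (pull_map f phi (opreim f V) (adj_unit f F V t)) y Vy.
    by rewrite /= !stalk_map_germ.
  rewrite !stalk_map_germ.
  have K W (u : pull f F W) : psi W (pull_map f phi W u) = u.
    exact: (congr1 (fun m : shmor _ _ => m W u) psiK).
  by rewrite !K => /pull_germE.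
elim/stalkW: h => U Uy t.
exists (val (psi (opreim f U) (adj_unit f H U t)) y Uy).
exact: (congr1 (fun m : shmor (pull f H) (pull f H) =>
  val (m (opreim f U) (adj_unit f H U t)) y Uy) phiK).
Qed.

(** * Adjoint transpose $f^{-1}F \to G$ of a morphism $F \to f_*G$ *)

Section Transpose.
Variables (R : pzRingType) (Y X : topologicalType) (f : continuousType Y X).
Variables (F : sheaf R X) (G : sheaf R Y).
Variable psi : shmor F (push f G).

(** The composite $F_{f(y)} \to (f_*G)_{f(y)} \to G_y$, computed on a chosen representative. *)
Definition stalk_transpose (y : Y) (g : stalk F (f y)) : stalk G y :=
  germ G (U := opreim f (gdom (repr g))) (gmem (repr g)) (psi _ (gsec (repr g))).

Lemma stalk_transpose_germ (y : Y) (U : opens X) (Uy : oset U (f y)) (s : F U) :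
  stalk_transpose (germ F Uy s) = germ G (U := opreim f U) Uy (psi U s).
Proof.
have /germ_eqP[W [Wg [Wh [Wx e]]]] :
    germ F (gmem (repr (germ F Uy s))) (gsec (repr (germ F Uy s))) = germ F Uy s.
  by rewrite -[RHS]reprK /germ; case: (repr _).
apply/germ_eqP; exists (opreim f W), (opreimS Wg), (opreimS Wh); split=> //=.
have := congr1 (psi W) e; rewrite !shapp_res; exact.
Qed.

Lemma stalk_transpose_linear (y : Y) : linear (@stalk_transpose y).
Proof.
move=> a; elim/stalkW => U Ux s; elim/stalkW => V Vx t.
have l : opensI U V `<=` U by exact: opensIl.
have r : opensI U V `<=` V by exact: opensIr.
have W : oset (opensI U V) (f y) by split.
rewrite -(germ_res l W Ux s) -(germ_res r W Vx t).
by rewrite -germ_linear !stalk_transpose_germ linearP germ_linear.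
Qed.

Lemma transpose_exists (V : opens Y) (s : pull f F V) :
  exists t : G V, forall y (Vy : oset V y),
    germ G Vy t = stalk_transpose (val s y Vy).
Proof.
apply: germ_glue => y0 Vy0.
have [W [U [t [WU [Wy sE]]]]] := submodP s y0 Vy0.
exists W, (res G WU (psi U t)); split=> // y Vy Wy'.
rewrite (sE y Vy Wy') stalk_transpose_germ; exact/esym/germ_res.
Qed.

Definition transpose_sec (V : opens Y) (s : pull f F V) : G V :=
  projT1 (cid (transpose_exists s)).

Lemma germ_transpose_sec (V : opens Y) (s : pull f F V) (y : Y) (Vy : oset V y) :
  germ G Vy (transpose_sec s) = stalk_transpose (val s y Vy).
Proof. exact: (projT2 (cid (transpose_exists s))). Qed.

Lemma transpose_linear (V : opens Y) : linear (@transpose_sec V).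
Proof.
move=> a s t; apply: germ_inj => y Vy.
rewrite (germ_transpose_sec (a *: s + t) Vy).
rewrite submodE !dprodE stalk_transpose_linear.
rewrite [RHS]germ_linear (germ_transpose_sec s Vy).
by rewrite (germ_transpose_sec t Vy).
Qed.

Lemma transpose_res (U V : opens Y) (h : U `<=` V) (s : pull f F V) :
  mklin (@transpose_linear U) (res (pull f F) h s) =
  res G h (mklin (@transpose_linear V) s).
Proof.
apply: germ_inj => y Uy; rewrite (germ_res (F := G) h Uy (h y Uy)).
change (germ G Uy (transpose_sec (res (pull f F) h s)) = germ G (h y Uy) (transpose_sec s)).
by rewrite (germ_transpose_sec (res (pull f F) h s) Uy) germ_transpose_sec.
Qed.

Definition transpose : shmor (pull f F) G := ShMor transpose_res.

Lemma germ_transpose (V : opens Y) (s : pull f F V) (y : Y) (Vy : oset V y) :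
  germ G Vy (transpose V s) = stalk_transpose (val s y Vy).
Proof. exact: germ_transpose_sec. Qed.

Lemma transpose_unit : shcomp (push_map f transpose) (adj_unit f F) = psi.
Proof.
apply: shmor_eq => U s; apply: (@germ_inj _ _ G (opreim f U)) => y Uy.
apply: etrans (germ_transpose (adj_unit f F U s) Uy) _.
exact: stalk_transpose_germ.
Qed.

(** Under the identification of stalks in [pull_germE], the stalk map of [transpose] is
    [stalk_transpose]. *)
Lemma transpose_is_iso :
  (forall y, injective (@stalk_transpose y)) ->
  (forall y h, exists g, @stalk_transpose y g = h) ->
  @is_iso (Sh R Y) (pull f F) G transpose.
Proof.
move=> inj surj; apply: shmor_is_iso_stalk => y.
  elim/stalkW=> V Vy s; elim/stalkW=> W Wy t.
  by rewrite !stalk_map_germ !germ_transpose => /inj/pull_germE.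
move=> h; have [g <-] := surj y h; elim/stalkW: g => U Uy s.
exists (germ (pull f F) (U := opreim f U) Uy (adj_unit f F U s)).
by rewrite stalk_map_germ germ_transpose.
Qed.

End Transpose.

(** * Inverting natural isomorphisms; finite intersections of neighbourhoods *)

Lemma naturally_isomorphic_sym (C D : category) (F G : functor C D) :
  naturally_isomorphic F G -> naturally_isomorphic G F.
Proof.
case=> t [nat_t iso_t].
have uP x : { u : mor (G x) (F x) | compm u (t x) = idm _ /\ compm (t x) u = idm _ }.
  exact: cid (iso_t x).
exists (fun x => sval (uP x)); split=> [x y f|x].
  have tu := proj2 (svalP (uP x)); have ut := proj1 (svalP (uP y)).
  move: (sval (uP x)) (sval (uP y)) tu ut => u v tu vt.
  rewrite -[RHS]comp1m -vt -[RHS]compmA; congr compm.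
  by rewrite compmA nat_t -compmA tu compm1.
by case: (uP x) => u [ut tu]; exists (t x).
Qed.

(** Intersects finitely many neighbourhoods. As [P] is not assumed stable under shrinking, it is
    kept on opens containing [W]. *)
Lemma opens_forall (X : topologicalType) (I : finType) (x : X)
    (P : I -> opens X -> Prop) :
  (forall i, exists U, oset U x /\ P i U) ->
  exists W, oset W x /\ forall i, exists2 U : opens X, W `<=` U & P i U.
Proof.
move=> H; have [U UP] := choice H.
have : nbhs x [set z | forall i, oset (U i) z].
  apply: filter_forall => i; apply: open_nbhs_nbhs.
  by split; [exact: osetP|exact: (proj1 (UP i))].
rewrite nbhsE => -[W [Wo Wx] WU].
exists (Opens Wo); split=> // i; exists (U i); last exact: (proj2 (UP i)).
by move=> z /WU.
Qed.

(** * Germs along the inclusion of a subspace *)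

Section Inclusion.
Variables (R : pzRingType) (X : topologicalType) (A : set X).
Local Notation i_A := (@incl X A).

Lemma opreim_incl (y : A) (W : opens A) : oset W y ->
  exists2 U : opens X, oset U (i_A y) & opreim i_A U `<=` W.
Proof.
case: W => W /= Wo Wy; have [U Uo e] := Wo.
exists (Opens Uo) => /=; first by move: Wy; rewrite -e.
by rewrite -e.
Qed.

(** The map $(i_*G)_{i(y)} \to G_y$ is injective because traces of opens of $X$ form a neighbourhood
    basis in the induced topology; for a general continuous map it need not be. *)
Lemma germ_push_incl (G : sheaf R A) (y : A) (U V : opens X)
    (Uy : oset U (i_A y)) (Vy : oset V (i_A y))
    (s : G (opreim i_A U)) (t : G (opreim i_A V)) :
  germ G (U := opreim i_A U) Uy s = germ G (U := opreim i_A V) Vy t ->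
  germ (push i_A G) Uy s = germ (push i_A G) Vy t.
Proof.
move=> /germ_eqP[W [WU [WV [Wy e]]]].
have [O Oy OW] := opreim_incl Wy.
pose Z := opensI O (opensI U V).
have ZU : Z `<=` U by move=> z [_ []].
have ZV : Z `<=` V by move=> z [_ []].
have ZW : opreim i_A Z `<=` W by move=> z [/OW].
apply/germ_eqP; exists Z, ZU, ZV; split; first by [].
rewrite /= (res_irr (opreimS ZU) (subset_trans ZW WU)).
rewrite (res_irr (opreimS ZV) (subset_trans ZW WV)).
by rewrite -(res_comp ZW WU) -(res_comp ZW WV) e.
Qed.

End Inclusion.

(** * Neighbourhoods and germs on a stratified space *)

Section Equivalence.
Variables (R : pzRingType) (X : topologicalType) (S : stratification X).
Local Notation idx := 'I_(sdim S).+1.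
Local Notation i_ k := (@incl X (S k)).

Lemma strat_point (x : X) : exists k (y : S k), i_ k y = x.
Proof.
have : [set: X] x by [].
rewrite -(strat_cover S) => -[k _ Sx].
by exists k, (exist _ x (mem_set Sx)).
Qed.

Lemma strat_avoid (k l : idx) (y : S k) : (l < k)%N ->
  (* The open set is the complement of the closed union of the $S_j$ with $j \le l$; disjointness
     keeps [y] in it. *)
  exists2 U : opens X, oset U (i_ k y) & forall z : S l, ~ oset U (i_ l z).
Proof.
move=> lk; pose C := \bigcup_(j in [set j : idx | (j <= l)%N]) S j.
have Co : open (~` C) by apply: closed_openC; exact: strat_closed.
exists (Opens Co) => [[j /= jl Sj]|[z Sz] nC]; last first.
  by apply: nC; exists l => //=; exact: set_mem.
have e : j = k.
  apply: (@strat_disjoint _ S j k) => //; exists (i_ k y); split=> //.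
  by case: y {Sj} => y Sy; exact: set_mem.
by move: jl lk; rewrite e leqNgt => /negP.
Qed.

(** For $l<k$ the stalk of $i_{l*}G$ at a point of $S_k$ vanishes: over an open missing $S_l$ any
    two sections agree, there being no germs to compare. *)
Lemma germ_push_lower (k l : idx) (G : sheaf R (S l)) (y : S k) (U V : opens X)
    (Uy : oset U (i_ k y)) (Vy : oset V (i_ k y))
    (s : push (i_ l) G U) (t : push (i_ l) G V) : (l < k)%N ->
  germ (push (i_ l) G) Uy s = germ (push (i_ l) G) Vy t.
Proof.
move=> /(strat_avoid y)[O Oy OP].
pose Z := opensI O (opensI U V).
have ZU : Z `<=` U by move=> z [_ []].
have ZV : Z `<=` V by move=> z [_ []].
apply/germ_eqP; exists Z, ZU, ZV; split; first by [].
by apply: (@germ_inj _ _ G) => z Zz; case: (OP z (proj1 Zz)).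
Qed.

(** * The projections $Q_\Sigma F \to i_{k*}F_k$ on stalks *)

Section Proj.
Variable F : strat_sheaf R S.

Lemma glue_proj_linear k U : linear (fun s : glue_obj F U =>
  (val s k : push (i_ k) (F k) U)).
Proof. by move=> a s t; rewrite submodE dprodE. Qed.

Definition glue_proj (k : idx) : shmor (glue_obj F) (push (i_ k) (F k)) :=
  @ShMor _ _ (glue_obj F) (push (i_ k) (F k))
    (fun U => mklin (@glue_proj_linear k U)) (fun U V h s => erefl).

Lemma glue_compatible (k l : idx) (kl : (k < l)%N) :
  shcomp (push_map (i_ k) (glue F kl)) (glue_proj k) =
  shcomp (adj_unit (i_ k) (push (i_ l) (F l))) (glue_proj l).
Proof. by apply: shmor_eq => U s; exact: (submodP s k l kl). Qed.

Lemma glue_stalk_inj (k : idx) (y : S k) :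
  injective (@stalk_transpose _ _ _ _ _ _ (glue_proj k) y).
Proof.
elim/stalkW=> U Uy s; elim/stalkW=> V Vy t.
rewrite !stalk_transpose_germ => e.
have germE l : germ (push (i_ l) (F l)) Uy (val s l) =
               germ (push (i_ l) (F l)) Vy (val t l).
  have [lk|kl|lk] := ltngtP l k.
  - exact: germ_push_lower.
  (* The value of $\eta_{kl}(u_l)$ at $y$ is the germ of $u_l$, so compatibility expresses this germ
     through $f_{lk}(u_k)$, hence through the germ of $u_k$. *)
  - have eval W (Wy : oset W (i_ k y)) (u : glue_obj F W) :
        val (glue F kl (opreim (i_ k) W) (val u k)) y Wy =
        germ (push (i_ l) (F l)) Wy (val u l).
      exact: (congr1 (fun v : pull (i_ k) (push (i_ l) (F l)) (opreim (i_ k) W) =>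
        val v y Wy) (submodP u k l kl)).
    rewrite -!eval; apply/pull_germE.
    by rewrite -[LHS]stalk_map_germ -[RHS]stalk_map_germ e.
  - move/val_inj: lk => ->; exact: germ_push_incl.
(* There are finitely many components, so their germ equalities hold on one common neighbourhood. *)
have [l|W [Wy WP]] := @opens_forall X idx (i_ k y) (fun l W => exists (WU : W `<=` U) (WV : W `<=` V),
  res (push (i_ l) (F l)) WU (val s l) = res (push (i_ l) (F l)) WV (val t l)).
  have /germ_eqP[W [WU [WV [Wy el]]]] := germE l.
  by exists W; split=> //; exists WU, WV.
have [O0 W0 [WU0 [WV0 _]]] := WP k.
have WU : W `<=` U by exact: subset_trans W0 WU0.
have WV : W `<=` V by exact: subset_trans W0 WV0.
apply/germ_eqP; exists W, WU, WV; split; first by [].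
apply: val_inj; apply: functional_extensionality_dep => l /=.
have [O WO [OU [OV el]]] := WP l.
have := congr1 (res (push (i_ l) (F l)) WO) el.
by rewrite (res_comp _ _ WU) (res_comp _ _ WV).
Qed.

(* The components of index l > k near y are read off f_{lk}(g); condition [glueP]
   makes the resulting family compatible. *)
Lemma glue_stalk_surj (k : idx) (y : S k) (h : stalk (F k) y) :
  exists g, @stalk_transpose _ _ _ _ _ _ (glue_proj k) y g = h.
Proof.
elim/stalkW: h => W Wy g.
(* [Q] prescribes the germ of component [l]: the value of $f_{lk}(g)$ at $y$ above [k], the germ of
   [g] itself at [k], nothing below. The transport [eq_rect] handles $l=k$, which is only a
   propositional equality. *)
pose Q l U (Ux : oset U (i_ k y)) (t : push (i_ l) (F l) U) :=
  (forall kl : (k < l)%N,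
     val (glue F kl W g) y Wy = germ (push (i_ l) (F l)) Ux t) /\
  (forall e : l = k, germ (F k) (U := opreim (i_ k) U) Ux
     (eq_rect l (fun j => F j (opreim (i_ j) U)) t k e) = germ (F k) Wy g).
have Qex l : exists U, oset U (i_ k y) /\
    exists t : push (i_ l) (F l) U, forall Ux, @Q l U Ux t.
  have [lk|kl|lk] := ltngtP l k.
  (* Below [k] the stalk vanishes, so 0 serves as component. *)
  - exists (Opens openT); split=> //; exists 0 => Ux; split=> [kl|e].
      by exfalso; have := ltn_trans lk kl; rewrite ltnn.
    by exfalso; move: lk; rewrite e ltnn.
  - have [V [U [t [VU [Vy gE]]]]] := submodP (glue F kl W g) y Wy.
    exists U; split; first exact: (VU y Vy).
    exists t => Ux; split=> [kl'|e].
      by rewrite (Prop_irrelevance kl' kl) (gE y Wy Vy); exact: germ_irr.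
    by exfalso; have := kl; rewrite e ltnn.
  - move/val_inj: lk => ->.
    have [U Uy UW] := opreim_incl Wy.
    exists U; split=> //; exists (res (F k) UW g) => Ux; split=> [kk|e].
      by exfalso; rewrite ltnn in kk.
    rewrite (Prop_irrelevance e erefl) /=; exact: germ_res.
have [U0 [U0y U0P]] := opens_forall Qex.
have tex l : exists t : push (i_ l) (F l) U0, Q l U0 U0y t.
  have [U U0U [t tQ]] := U0P l; have [Q1 Q2] := tQ (U0U _ U0y).
  exists (res (push (i_ l) (F l)) U0U t); split=> [kl|e].
    by rewrite (germ_res (F := push (i_ l) (F l)) U0U U0y (U0U _ U0y)) -Q1.
  subst l; rewrite -(Q2 erefl) /=; exact: germ_res.
pose t l := projT1 (cid (tex l)).
have tk (l : idx) (kl : (k < l)%N) :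
    val (glue F kl W g) y Wy = germ (push (i_ l) (F l)) U0y (t l).
  exact: (proj1 (projT2 (cid (tex l)))).
have tkk : germ (F k) (U := opreim (i_ k) U0) U0y (t k) = germ (F k) Wy g.
  exact: (proj2 (projT2 (cid (tex k))) erefl).
(* The compatibility conditions are first checked on germs at [y], then spread to a
   neighbourhood. *)
have compat (l m : idx) (lm : (l < m)%N) :
    germ (push (i_ l) (pull (i_ l) (push (i_ m) (F m)))) U0y
      (push_map (i_ l) (glue F lm) U0 (t l)) =
    germ (push (i_ l) (pull (i_ l) (push (i_ m) (F m)))) U0y
      (adj_unit (i_ l) (push (i_ m) (F m)) U0 (t m)).
  have [lk|kl|lk] := ltngtP l k.
  - exact: germ_push_lower.
  (* For $k<l<m$, [glueP] applied to [g] and read at $y$ relates the germs prescribed for the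
     components [l] and [m]. *)
  - have km := ltn_trans kl lm.
    have := congr1 (fun v : shmor (F k) (pull (i_ k) (push (i_ l)
      (pull (i_ l) (push (i_ m) (F m))))) => val (v W g) y Wy) (glueP F kl lm km).
    by rewrite /= !tk !stalk_map_germ.
  - move/val_inj: lk => lk; subst l.
    (* Here $l=k$: both sides are sections of an inverse image on $S_k$, so it is enough to compare
       their values at $y$. *)
    apply: germ_push_incl; apply/pull_germE.
    rewrite [RHS](_ : _ = val (glue F lm W g) y Wy); last exact/esym/tk.
    by apply/pull_germE; rewrite -[LHS]stalk_map_germ -[RHS]stalk_map_germ tkk.
have [[l m]|U [Uy UP]] := @opens_forall X (idx * idx)%type (i_ k y)
    (fun lm U => exists UU0 : U `<=` U0, forall lt : (lm.1 < lm.2)%N,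
      res (push (i_ lm.1) (pull (i_ lm.1) (push (i_ lm.2) (F lm.2)))) UU0
        (push_map (i_ lm.1) (glue F lt) U0 (t lm.1)) =
      res (push (i_ lm.1) (pull (i_ lm.1) (push (i_ lm.2) (F lm.2)))) UU0
        (adj_unit (i_ lm.1) (push (i_ lm.2) (F lm.2)) U0 (t lm.2))).
  (* Pairs with $m \le l$ carry no condition and keep [U0]. *)
  have /orP[ml|lm] := leqVgt m l.
    exists U0; split=> //; exists (@subset_refl _ _) => /= lm.
    by move: ml; rewrite leqNgt lm.
  have /germ_eqP[U [UU0 [UU0' [Uy e]]]] := compat l m lm.
  exists U; split=> //; exists UU0 => lt.
  rewrite [RHS](res_irr _ UU0') (Prop_irrelevance lt lm); exact: e.
(* The pair $(k,k)$ is taken only to extract the inclusion of [U] in [U0]. *)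
have [O0 UO0 [O0U0 _]] := UP (k, k).
have UU0 : U `<=` U0 by exact: subset_trans UO0 O0U0.
pose u : dprod (fun l : idx => push (i_ l) (F l) U) :=
  fun l => res (push (i_ l) (F l)) UU0 (t l).
have uP : compatible u.
  move=> l m lm; rewrite /u !shapp_res.
  have [O UO [OU0 e]] := UP (l, m).
  have := congr1 (res (push (i_ l) (pull (i_ l) (push (i_ m) (F m)))) UO) (e lm).
  by rewrite (res_comp _ _ UU0) (res_comp _ _ UU0).
exists (germ (glue_obj F) Uy (mksub (@compatible_closed _ _ _ F U) uP)).
rewrite stalk_transpose_germ -tkk; exact: germ_res.
Qed.

End Proj.

(** * The natural isomorphism $R_\Sigma Q_\Sigma \to \mathrm{id}$ *)

Definition restr_glue_comp (F : strat_sheaf R S) (k : idx) :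
    shmor (pull (i_ k) (glue_obj F)) (F k) :=
  transpose (glue_proj F k).

(** Under the adjunction the two sides become those of [glue_compatible]. *)
Lemma restr_glue_smorP (F : strat_sheaf R S) (k l : idx) (kl : (k < l)%N) :
  shcomp (glue F kl) (restr_glue_comp F k) =
  shcomp (pull_map (i_ k) (push_map (i_ l) (restr_glue_comp F l)))
    (glue (restr_obj S (glue_obj F)) kl).
Proof.
apply: pull_mor_ext.
rewrite -[in RHS]pull_map_comp transpose_unit -adj_unit_nat -glue_compatible.
by rewrite push_map_comp -shcompA transpose_unit.
Qed.

Definition restr_glue (F : strat_sheaf R S) :
    strat_mor (restr_obj S (glue_obj F)) F :=
  @StratMor _ _ _ (restr_obj S (glue_obj F)) F (restr_glue_comp F)
    (@restr_glue_smorP F).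

(** Both sides are adjoint to the map sending a compatible family to $\phi_k$ of its component
    [k]. *)
Lemma restr_glue_nat (F G : strat_sheaf R S) (phi : strat_mor F G) :
  strat_comp (restr_glue G) (restr_mor S (glue_mor phi)) =
  strat_comp phi (restr_glue F).
Proof.
apply: strat_mor_eq => k; apply: pull_mor_ext.
change (shcomp (push_map (i_ k) (shcomp (restr_glue_comp G k)
    (pull_map (i_ k) (glue_mor phi)))) (adj_unit (i_ k) (glue_obj F)) =
  shcomp (push_map (i_ k) (shcomp (phi k) (restr_glue_comp F k)))
    (adj_unit (i_ k) (glue_obj F))).
rewrite (push_map_comp _ (restr_glue_comp G k)) (push_map_comp _ (phi k)).
rewrite -[LHS]shcompA -[RHS]shcompA -(adj_unit_nat _ (glue_mor phi)).
rewrite [LHS]shcompA transpose_unit transpose_unit.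
exact: shmor_eq.
Qed.

Lemma strat_mor_is_iso (F G : strat_sheaf R S) (phi : strat_mor F G) :
  (forall k, @is_iso (Sh R (S k)) (F k) (G k) (phi k)) ->
  @is_iso (StratSh R S) F G phi.
Proof.
move=> iso_phi.
pose psi k : shmor (G k) (F k) := projT1 (cid (iso_phi k)).
have phiK k : shcomp (psi k) (phi k) = shid (F k) := proj1 (projT2 (cid (iso_phi k))).
have psiK k : shcomp (phi k) (psi k) = shid (G k) := proj2 (projT2 (cid (iso_phi k))).
have psiP (k l : idx) (kl : (k < l)%N) : shcomp (glue F kl) (psi k) =
    shcomp (pull_map (i_ k) (push_map (i_ l) (psi l))) (glue G kl).
  (* Inserting $\phi_k\psi_k=\mathrm{id}$ lets the commutation for [phi] yield the one for [psi]. *)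
  have -> : glue G kl = shcomp (shcomp (glue G kl) (phi k)) (psi k).
    by rewrite -shcompA psiK; exact: shmor_eq.
  rewrite smorP !shcompA -pull_map_comp -push_map_comp phiK push_map_id pull_map_id.
  exact: shmor_eq.
by exists (StratMor psiP); split; apply: strat_mor_eq => k; [exact: phiK|exact: psiK].
Qed.

Lemma restr_glue_comp_is_iso (F : strat_sheaf R S) (k : idx) :
  @is_iso (Sh R (S k)) (pull (i_ k) (glue_obj F)) (F k) (restr_glue_comp F k).
Proof. by apply: transpose_is_iso; [exact: glue_stalk_inj|exact: glue_stalk_surj]. Qed.

(** * The natural isomorphism $\mathrm{id} \to Q_\Sigma R_\Sigma$ *)

Section GlueRestr.
Variable F : sheaf R X.

(** This is naturality of the unit of $i_k$ with respect to the unit of $i_l$. *)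
Lemma unit_compatible (U : opens X) (s : F U) :
  @compatible R X S (restr_obj S F) U (fun k => adj_unit (i_ k) F U s).
Proof.
move=> k l kl.
exact: esym (congr1 (fun m : shmor _ _ => m U s) (adj_unit_nat (i_ k) (adj_unit (i_ l) F))).
Qed.

Lemma glue_unit_linear (U : opens X) : linear (fun s : F U =>
  mksub (@compatible_closed _ _ _ (restr_obj S F) U) (unit_compatible s)).
Proof.
move=> a s t; apply: val_inj; apply: functional_extensionality_dep => k.
exact: linearP.
Qed.

Lemma glue_unit_res (U V : opens X) (h : U `<=` V) (s : F V) :
  mklin (@glue_unit_linear U) (res F h s) =
  res (glue_obj (restr_obj S F)) h (mklin (@glue_unit_linear V) s).
Proof.
apply: val_inj; apply: functional_extensionality_dep => k.
exact: (shapp_res (adj_unit (i_ k) F)).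
Qed.

Definition glue_unit : shmor F (glue_obj (restr_obj S F)) :=
  @ShMor _ _ F (glue_obj (restr_obj S F)) _ glue_unit_res.

Lemma glue_unit_proj (k : idx) :
  shcomp (glue_proj (restr_obj S F) k) glue_unit = adj_unit (i_ k) F.
Proof. exact: shmor_eq. Qed.

(** Both sides are adjoint to the unit of $i_k$. *)
Lemma restr_glue_unit (k : idx) :
  shcomp (restr_glue_comp (restr_obj S F) k) (pull_map (i_ k) glue_unit) =
  shid (pull (i_ k) F).
Proof.
apply: pull_mor_ext.
rewrite push_map_comp -shcompA -adj_unit_nat shcompA transpose_unit glue_unit_proj.
exact: shmor_eq.
Qed.

Lemma glue_unit_is_iso : @is_iso (Sh R X) F (glue_obj (restr_obj S F)) glue_unit.
Proof.
have iso k : @is_iso (Sh R (S k)) (pull (i_ k) F)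
    (pull (i_ k) (glue_obj (restr_obj S F))) (pull_map (i_ k) glue_unit).
  have [psi [psiK phiK]] := restr_glue_comp_is_iso (restr_obj S F) k.
  (* A right inverse of an isomorphism is its two-sided inverse. *)
  have e : pull_map (i_ k) glue_unit = psi.
    rewrite -[LHS](@comp1m (Sh R (S k))) -psiK -(@compmA (Sh R (S k))).
    by rewrite [X in compm psi X]restr_glue_unit (@compm1 (Sh R (S k))).
  by rewrite e; exists (restr_glue_comp (restr_obj S F) k).
apply: shmor_is_iso_stalk => x; have [k [y <-]] := strat_point x.
  exact: (stalk_map_pull_iso (iso k) y).1.
exact: (stalk_map_pull_iso (iso k) y).2.
Qed.

End GlueRestr.

Lemma glue_unit_nat (F G : sheaf R X) (phi : shmor F G) :
  shcomp (glue_unit G) phi = shcomp (glue_mor (restr_mor S phi)) (glue_unit F).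
Proof.
apply: shmor_eq => U s; apply: val_inj; apply: functional_extensionality_dep => k.
exact: (congr1 (fun m : shmor _ _ => m U s) (adj_unit_nat (i_ k) phi)).
Qed.

Lemma restr_glue_quasi_inverse :
  quasi_inverse (restr_functor R S) (glue_functor R S).
Proof.
split.
  (* The definition asks for a map $Q_\Sigma R_\Sigma \to \mathrm{id}$, while [glue_unit] goes the
     other way. *)
  apply: naturally_isomorphic_sym; exists glue_unit; split; first exact: glue_unit_nat.
  exact: glue_unit_is_iso.
exists restr_glue; split; first exact: restr_glue_nat.
by move=> F; apply: strat_mor_is_iso => k; exact: restr_glue_comp_is_iso.
Qed.

End Equivalence.

Theorem mainTheorem5 (R : pzRingType) (X : topologicalType)
    (S : stratification X) :
  equivalent_categories (Sh R X) (StratSh R S) /\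
  quasi_inverse (restr_functor R S) (glue_functor R S).
Proof.
split; last exact: restr_glue_quasi_inverse.
exists (restr_functor R S), (glue_functor R S).
exact: restr_glue_quasi_inverse.
Qed.
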